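(* Let $V$ be a finite set, let $\{Z_s\}_{s\in V}$ be a Gaussian process with prior mean $\mu_s$ and prior covariance $\sigma_{ss'}$ for $s,s'\in V$, and let $U\subset V$ be a common support set known to all $K$ mobile sensors. For $k=1,\dots,K$ let $D_k\subset V$ be the set of segments observed by sensor $k$, with measurement vector $z_{D_k}$, let $D=\bigcup_{k=1}^K D_k$ (the $D_k$ being the blocks of a partition of $D$), and let $z_D$ be the vector of all measurements. Let $Y\subseteq V\setminus D$ be any set of unobserved segments. Let $(\ddot z_U,\ddot\Sigma_{UU})$ be the global summary built from the local summaries $(\dot z^k_U,\dot\Sigma^k_{UU})$, $k=1,\dots,K$, as defined in the context. (A) Given the global summary $(\ddot z_U,\ddot\Sigma_{UU})$, each mobile sensor computes a globally consistent (i.e. the same for every sensor) predictive Gaussian distribution $\mathcal N(\overline\mu_Y,\overline\Sigma_{YY})$ of the measurements at $Y$, where $$\overline\mu_Y \triangleq \mu_Y+\Sigma_{YU}\ddot\Sigma_{UU}^{-1}\ddot z_U,\qquad \overline\Sigma_{YY}\triangleq \Sigma_{YY}-\Sigma_{YU}\left(\Sigma_{UU}^{-1}-\ddot\Sigma_{UU}^{-1}\right)\Sigma_{UY}.$$ (B) Let $\mathcal N(\mu^{\mathrm{PITC}}_{Y|D},\Sigma^{\mathrm{PITC}}_{YY|D})$ be the predictive Gaussian distribution computed by the centralized sparse partially independent training conditional (PITC) approximation of the Gaussian process model, i.e. $$\mu^{\mathrm{PITC}}_{Y|D}\triangleq \mu_Y+\Gamma_{YD}(\Gamma_{DD}+\Lambda)^{-1}(z_D-\mu_D),\qquad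 \Sigma^{\mathrm{PITC}}_{YY|D}\triangleq\Sigma_{YY}-\Gamma_{YD}(\Gamma_{DD}+\Lambda)^{-1}\Gamma_{DY},$$ where $\Gamma_{BB'}\triangleq\Sigma_{BU}\Sigma_{UU}^{-1}\Sigma_{UB'}$ for $B,B'\subseteq V$, and $\Lambda$ is the block-diagonal matrix constructed from the $K$ diagonal blocks $\Sigma_{D_kD_k|U}$, $k=1,\dots,K$, of $\Sigma_{DD|U}$. Then $$\overline\mu_Y=\mu^{\mathrm{PITC}}_{Y|D}\quad\text{and}\quad \overline\Sigma_{YY}=\Sigma^{\mathrm{PITC}}_{YY|D}.$$
   Context: For $B,B'\subseteq V$: $\mu_B$ is the column vector of the means $\mu_s$, $s\in B$; $\Sigma_{BB'}$ is the covariance matrix with entries $\sigma_{ss'}$, $s\in B$, $s'\in B'$ (so $\Sigma_{B'B}=\Sigma_{BB'}^\top$). The prior covariance $\sigma$ is symmetric and positive semidefinite. For $B\subseteq V$, the posterior covariance given $U$ is $$\Sigma_{BB|U}\triangleq\Sigma_{BB}-\Sigma_{BU}\Sigma_{UU}^{-1}\Sigma_{UB}.$$ Local summary of sensor $k$: the pair $(\dot z_U^k,\dot\Sigma_{UU}^k)$ with $$\dot z_U^k\triangleq\Sigma_{UD_k}\Sigma_{D_kD_k|U}^{-1}(z_{D_k}-\mu_{D_k}),\qquad \dot\Sigma_{UU}^k\triangleq\Sigma_{UD_k}\Sigma_{D_kD_k|U}^{-1}\Sigma_{D_kU}.$$ Global summary: the pair $(\ddot z_U,\ddot\Sigma_{UU})$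 with $$\ddot z_U\triangleq\sum_{k=1}^K\dot z_U^k,\qquad \ddot\Sigma_{UU}\triangleq\Sigma_{UU}+\sum_{k=1}^K\dot\Sigma_{UU}^k.$$ Convention: the matrices that are inverted ($\Sigma_{UU}$ and each $\Sigma_{D_kD_k|U}$) are invertible, hence positive definite. Part (A) serves as the definition of $\overline\mu_Y,\overline\Sigma_{YY}$; the mathematical assertion is the pair of equalities in part (B). *)

(* Defs.v *)
From HB Require Import structures.
From mathcomp Require Import all_boot all_order all_algebra.
From mathcomp Require Import all_classical all_reals all_analysis.

Set Implicit Arguments.
Unset Strict Implicit.
Unset Printing Implicit Defensive.
Import Order.TTheory GRing.Theory Num.Theory.
Import numFieldNormedType.Exports.

Local Open Scope ring_scope.

Section GaussianProcess.
Context {d : measure_display} {T : measurableType d} {R : realType}.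

(* The law N(m, s ^+ 2) on the line. The point mass is treated separately:
   normal_prob m 0 is not the Dirac measure but, by convention of the library,
   the uniform law on [0, 1]. *)
Definition gauss1 (m s : R) (A : set R) : \bar R :=
  if s == 0 then dirac m A else normal_prob m s A.

(* Every linear combination of the variables is (possibly degenerate) Gaussian,
   which for a finite index set says that the family is jointly Gaussian. *)
Definition gaussian_process (P : probability T R) (V : finType)
    (Z : V -> {RV P >-> R}) : Prop :=
  forall a : V -> R, exists m s : R, forall A : set R, measurable A ->
    P ((fun w => \sum_(i : V) a i * Z i w) @^-1` A)%classic = gauss1 m s A.

Definition has_prior_mean (P : probability T R) (V : finType)
    (Z : V -> {RV P >-> R}) (mu : V -> R) : Prop :=
  forall s, ('E_P[Z s] = (mu s)%:E)%E.

Definition has_prior_covariance (P : probability T R) (V : finType)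
    (Z : V -> {RV P >-> R}) (sigma : V -> V -> R) : Prop :=
  forall s s', (covariance P (Z s) (Z s') = (sigma s s')%:E)%E.

End GaussianProcess.

Definition cov_symmetric (R : realType) (V : finType) (sigma : V -> V -> R) :=
  forall s s', sigma s s' = sigma s' s.

Definition cov_psd (R : realType) (V : finType) (sigma : V -> V -> R) :=
  forall x : V -> R, 0 <= \sum_(s : V) \sum_(s' : V) x s * sigma s s' * x s'.

Section Regression.
Variables (R : realType) (V : finType).
Variables (mu : V -> R) (sigma : V -> V -> R) (U : {set V}).

(* A vector or matrix indexed by B : {set V} is indexed by 'I_#|B|, the i-th
   coordinate being the one of enum_val i, the i-th element of B. *)
Definition subvec (f : V -> R) (B : {set V}) : 'cV[R]_#|B| :=
  \col_i f (enum_val i).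

Definition covmx (B B' : {set V}) : 'M[R]_(#|B|, #|B'|) :=
  \matrix_(i, j) sigma (enum_val i) (enum_val j).

Definition Gamma (B B' : {set V}) : 'M[R]_(#|B|, #|B'|) :=
  covmx B U *m invmx (covmx U U) *m covmx U B'.

Definition postcov (B : {set V}) : 'M[R]_#|B| :=
  covmx B B - covmx B U *m invmx (covmx U U) *m covmx U B.

Section Summaries.
(* z s is the value measured at s; only its values on the sets D k are used. *)
Variables (z : V -> R) (K : nat) (D : 'I_K -> {set V}).

Definition local_z (k : 'I_K) : 'cV[R]_#|U| :=
  covmx U (D k) *m invmx (postcov (D k)) *m
  (subvec z (D k) - subvec mu (D k)).

Definition local_cov (k : 'I_K) : 'M[R]_#|U| :=
  covmx U (D k) *m invmx (postcov (D k)) *m covmx (D k) U.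

Definition global_z : 'cV[R]_#|U| := \sum_k local_z k.

Definition global_cov : 'M[R]_#|U| := covmx U U + \sum_k local_cov k.

Definition observed : {set V} := (\bigcup_k D k)%SET.

(* Block-diagonal up to the enumeration of the observed set: the entries of its
   posterior covariance inside the blocks D k x D k, and 0 elsewhere. *)
Definition Lambda : 'M[R]_#|observed| :=
  \matrix_(i, j)
    if [exists k, (enum_val i \in D k) && (enum_val j \in D k)]
    then postcov observed i j else 0.

Definition pitc_mean (Y : {set V}) : 'cV[R]_#|Y| :=
  subvec mu Y +
  Gamma Y observed *m invmx (Gamma observed observed + Lambda) *m
  (subvec z observed - subvec mu observed).

Definition pitc_cov (Y : {set V}) : 'M[R]_#|Y| :=
  covmx Y Y -
  Gamma Y observed *m invmx (Gamma observed observed + Lambda) *m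
  Gamma observed Y.

End Summaries.

(* The arguments zU, SU stand for a global summary: beyond the prior and the
   support set, a sensor's prediction depends on nothing else, hence is the same
   for all sensors. *)
Definition pred_mean (zU : 'cV[R]_#|U|) (SU : 'M[R]_#|U|) (Y : {set V}) :
    'cV[R]_#|Y| :=
  subvec mu Y + covmx Y U *m invmx SU *m zU.

Definition pred_cov (SU : 'M[R]_#|U|) (Y : {set V}) : 'M[R]_#|Y| :=
  covmx Y Y - covmx Y U *m (invmx (covmx U U) - invmx SU) *m covmx U Y.

End Regression.

(* Main.v *)
Require Import Defs.
From HB Require Import structures.
From mathcomp Require Import all_boot all_order all_algebra.
From mathcomp Require Import all_classical all_reals all_analysis.
From mathcomp Require Import ring lra.
Import Order.TTheory GRing.Theory Num.Theory.
Import numFieldNormedType.Exports.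
Local Open Scope ring_scope.

(** Write S = Sigma_UU, B = Sigma_UD, C = Sigma_DU, L = Lambda. Since L is block
diagonal, B L^-1 C and B L^-1 (z - mu) split into the sums of the local
summaries, so that the global covariance is G = S + B L^-1 C. It is invertible
because S is positive definite and each Schur complement Sigma_{D_k D_k | U},
hence its inverse, is positive semidefinite. Both equalities then follow from
the push-through identity S^-1 B (C S^-1 B + L)^-1 = G^-1 B L^-1. *)

(** * The Woodbury and push-through identities *)

Section Woodbury.
Context {F : comUnitRingType} {m n : nat}.
Context {S : 'M[F]_m} {L : 'M[F]_n} {B : 'M[F]_(m, n)} {C : 'M[F]_(n, m)}.
Hypotheses (unitS : S \in unitmx) (unitL : L \in unitmx).
Hypothesis unitG : S + B *m invmx L *m C \in unitmx.

(** With M = C S^-1 B + L, the identity G S^-1 B = B L^-1 M makes the Woodbury expression L^-1 -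
    L^-1 C G^-1 B L^-1 a left inverse of M. *)
Lemma woodbury_unitmx : C *m invmx S *m B + L \in unitmx.
Proof.
move: unitG; set G := S + _ => uG; set M := _ + L.
have pushB : G *m (invmx S *m B) = B *m (invmx L *m M).
  rewrite /G /M mulmxDl mulmxDr mulmxDr (mulVmx unitL) mulmx1.
  by rewrite !mulmxA (mulmxV unitS) mul1mx addrC.
suff : (invmx L - invmx L *m C *m invmx G *m (B *m invmx L)) *m M = 1%:M.
  by case/mulmx1_unit.
rewrite mulmxBl -!mulmxA -pushB (mulKmx uG) /M mulmxDr (mulVmx unitL).
by rewrite -!mulmxA addrAC subrr add0r.
Qed.

(** After multiplication by G on the left and by M on the right, both sides become B + B L^-1 C S^-1
    B. *)
Lemma woodbury_push_through :
  invmx S *m B *m invmx (C *m invmx S *m B + L)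
    = invmx (S + B *m invmx L *m C) *m B *m invmx L.
Proof.
have unitM := woodbury_unitmx.
apply: (can_inj (mulmxK unitM)); rewrite (mulmxKV unitM).
move: unitG; set G := S + _ => uG.
apply: (can_inj (mulKmx uG)); rewrite -2!(mulmxA (invmx G)) (mulKVmx uG) /G.
rewrite mulmxDl mulmxDr -!mulmxA (mulVmx unitL) mulmx1 (mulKVmx unitS).
exact: addrC.
Qed.

End Woodbury.

(** * Positive semidefinite matrices *)

Section PositiveSemidefinite.
Context {F : realFieldType}.

(** Row vectors match the left kernel [kermx]; symmetry is assumed separately where it matters. *)
Definition psdmx {n} (A : 'M[F]_n) :=
  forall x : 'rV[F]_n, 0 <= (x *m A *m x^T) 0 0.

Lemma psdmx_congr {m n} (W : 'M[F]_(m, n)) (A : 'M[F]_n) :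
  psdmx A -> psdmx (W *m A *m W^T).
Proof. by move=> Apsd x; have := Apsd (x *m W); rewrite trmx_mul !mulmxA. Qed.

(** By symmetry A^-1 = A^-1 A (A^-1)^T, a congruence of A. *)
Lemma psdmx_inv {n} (A : 'M[F]_n) :
  A^T = A -> A \in unitmx -> psdmx A -> psdmx (invmx A).
Proof.
move=> symA unitA /(psdmx_congr (invmx A)).
by rewrite trmx_inv symA (mulVmx unitA) mul1mx.
Qed.

Lemma psdmx_sum {n} {I : finType} (A : I -> 'M[F]_n) :
  (forall i, psdmx (A i)) -> psdmx (\sum_i A i).
Proof.
move=> Apsd x; rewrite mulmx_sumr mulmx_suml summxE.
by apply: sumr_ge0 => i _; apply: Apsd.
Qed.

Lemma sqnorm_eq0 {n} (v : 'rV[F]_n) : (v *m v^T) 0 0 = 0 -> v = 0.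
Proof.
rewrite mxE => /eqP; rewrite psumr_eq0; last first.
  by move=> i _; rewrite mxE -expr2 sqr_ge0.
move/allP => v0; apply/rowP => i; have := v0 i (mem_index_enum _).
by rewrite !mxE mulf_eq0 orbb => /eqP.
Qed.

(** With y = x A, the form at x + t y is 2 t |y|^2 + t^2 c, which is negative for small t < 0 unless
    y = 0. *)
Lemma psdmx_isotropic {n} (A : 'M[F]_n) (x : 'rV[F]_n) :
  A^T = A -> psdmx A -> (x *m A *m x^T) 0 0 = 0 -> x *m A = 0.
Proof.
move=> symA Apsd qx0; apply: sqnorm_eq0.
set y := x *m A; set b := (y *m y^T) 0 0; set c := (y *m A *m y^T) 0 0.
have c_ge0 : 0 <= c by apply: Apsd.
have yAx : y *m A *m x^T = y *m y^T by rewrite /y trmx_mul symA !mulmxA.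
have xAy : x *m A *m y^T = y *m y^T by [].
have quad t : 0 <= t * b *+ 2 + t ^+ 2 * c.
  have := Apsd (x + t *: y).
  rewrite linearD linearZ /= !mulmxDl !mulmxDr -!scalemxAl -!scalemxAr yAx xAy.
  move: qx0; rewrite /b /c !mxE => ->; lra.
(* close to the minimiser - b / c of the quadratic, but c may vanish *)
have := quad (- b / (c + 1)).
have c1 : c + 1 != 0 by rewrite gt_eqF // ltr_wpDl.
have -> : - b / (c + 1) * b *+ 2 + (- b / (c + 1)) ^+ 2 * c
   = - ((b / (c + 1)) ^+ 2 * (c + 2)) by field.
rewrite oppr_ge0 pmulr_lle0; last by lra.
move=> le0; have : (b / (c + 1)) ^+ 2 == 0 by rewrite eq_le le0 sqr_ge0.
by rewrite sqrf_eq0 mulf_eq0 invr_eq0 (negPf c1) orbF => /eqP.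
Qed.

(** If x (A + H) = 0, the nonnegative numbers x A x^T and x H x^T add up to 0, so both vanish. Then
    x A = 0 by [psdmx_isotropic], and x = 0 since A is invertible. *)
Lemma unitmx_psdD {n} (A H : 'M[F]_n) :
  A^T = A -> A \in unitmx -> psdmx A -> psdmx H -> A + H \in unitmx.
Proof.
move=> symA unitA Apsd Hpsd; rewrite -row_free_unit -kermx_eq0.
apply/eqP/row_matrixP => i; rewrite row0; set x := row i _.
have xAH : x *m (A + H) = 0 by rewrite /x -row_mul mulmx_ker row0.
have qAH : (x *m A *m x^T) 0 0 + (x *m H *m x^T) 0 0 = 0.
  have /(congr1 (fun w : 'rV_n => (w *m x^T) 0 0)) := xAH.
  by rewrite mulmxDr mulmxDl mul0mx [in LHS]mxE => ->; rewrite mxE.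
have qA0 : (x *m A *m x^T) 0 0 = 0.
  by have := Apsd x; have := Hpsd x; lra.
by rewrite -(mulmxK unitA x) (psdmx_isotropic A x symA Apsd qA0) mul0mx.
Qed.

End PositiveSemidefinite.

(** * Passing between index sets by 0/1 matrices *)

Section Selection.
Context {F : comUnitRingType} {V : finType}.
Implicit Types A B C : {set V}.

(** For A inside B, left multiplication by this matrix restricts from B to A, and by its transpose
    extends by zero. Submatrices thus become products, whatever the enumerations of A and B. *)
Definition selmx A B : 'M[F]_(#|A|, #|B|) :=
  \matrix_(i, j) (enum_val i == enum_val j)%:R.

Lemma tr_selmx A B : (selmx A B)^T = selmx B A.
Proof. by apply/matrixP => i j; rewrite !mxE eq_sym. Qed.

(** Taking the entries from a function on V covers [subvec], [covmx] and [selmx] itself at once. *)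
Lemma selmx_mul A B n (f : V -> 'I_n -> F) : A \subset B ->
  selmx A B *m (\matrix_(i, j) f (enum_val i) j) =
    \matrix_(i, j) f (enum_val i) j.
Proof.
move=> sAB; apply/matrixP => i j; rewrite !mxE.
under eq_bigr do rewrite !mxE.
rewrite -(big_enum_val (fun s => (enum_val i == s)%:R * f s j)) /=.
have iB : enum_val i \in B by rewrite (fintype.subsetP sAB) // enum_valP.
rewrite (bigD1 (enum_val i)) //= eqxx mul1r big1 ?addr0 // => s /andP[_ ns].
by rewrite eq_sym (negPf ns) mul0r.
Qed.

Lemma selmx_id A : selmx A A = 1%:M.
Proof. by apply/matrixP => i j; rewrite !mxE (inj_eq enum_val_inj). Qed.

Lemma selmx_comp A B C : A \subset B -> selmx A B *m selmx B C = selmx A C.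
Proof. exact: (selmx_mul A B _ (fun s j => (s == enum_val j)%:R)). Qed.

Lemma selmx_disjoint A B : [disjoint A & B] -> selmx A B = 0.
Proof.
move=> dAB; apply/matrixP => i j; rewrite !mxE; case: eqP => // eij.
have := disjointFr dAB (enum_valP i).
by rewrite eij enum_valP.
Qed.

Lemma selmx_proj A B :
  selmx B A *m selmx A B = diag_mx (\row_i (enum_val i \in A)%:R).
Proof.
apply/matrixP => i j; rewrite !mxE.
under eq_bigr do rewrite !mxE.
rewrite -(big_enum_val
  (fun s => (enum_val i == s)%:R * (s == enum_val j)%:R)) /=.
have [iA|niA] := boolP (enum_val i \in A).
  rewrite (bigD1 (enum_val i)) //= eqxx mul1r (inj_eq enum_val_inj) big1.
    by rewrite addr0.
  by move=> s /andP[_ ns]; rewrite eq_sym (negPf ns) mul0r.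
rewrite big1 ?mul0rn // => s sA; case: eqP => [e|_]; last by rewrite mul0r.
by rewrite e sA in niA.
Qed.

End Selection.

(** * Block-diagonal matrices over disjoint blocks *)

Section BlockDiagonal.
Context {F : comUnitRingType} {V : finType} {K : nat} {D : 'I_K -> {set V}}.
Hypothesis D_disj : forall k l : 'I_K, k != l -> [disjoint D k & D l].

Let E k : 'M[F]_(#|D k|, #|observed D|) := selmx (D k) (observed D).
Let Et k : 'M[F]_(#|observed D|, #|D k|) := selmx (observed D) (D k).

Lemma sub_observed k : D k \subset observed D.
Proof. exact: finset.bigcup_sup. Qed.

Lemma sum_mem_block (s : V) (a : 'I_K -> F) k0 : s \in D k0 ->
  \sum_k (s \in D k)%:R * a k = a k0.
Proof.
move=> sk0; rewrite (bigD1 k0) //= sk0 mul1r big1 ?addr0 // => k nk.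
by rewrite (disjointFl (D_disj _ _ nk) sk0) mul0r.
Qed.

(** The k-th term is the diagonal mask of [D k], and each observed element lies in exactly one
    block. *)
Lemma sum_selmx_proj : \sum_k Et k *m E k = 1%:M.
Proof.
apply/matrixP => i j; rewrite summxE.
under eq_bigr do rewrite selmx_proj !mxE -[_ *+ (i == j)]mulr_natr.
have /finset.bigcupP[k0 _ ik0] := enum_valP i.
by rewrite (sum_mem_block _ (fun=> (i == j)%:R) _ ik0) mxE.
Qed.

(** Reconciles the entrywise form of [Lambda] with a sum of embedded blocks: the k-th term masks the
    rows and columns of A to [D k], and only the block containing the row element can contribute. *)
Lemma blockdiag_mask (A : 'M[F]_#|observed D|) :
  \sum_k Et k *m (E k *m A *m Et k) *m E k =
  \matrix_(i, j)
    if [exists k, (enum_val i \in D k) && (enum_val j \in D k)]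
    then A i j else 0.
Proof.
apply/matrixP => i j; rewrite summxE.
under eq_bigr => k _.
  rewrite -!mulmxA selmx_proj !mulmxA selmx_proj mul_mx_diag mul_diag_mx !mxE.
  rewrite -mulrA; over.
have /finset.bigcupP[k0 _ ik0] := enum_valP i.
rewrite (sum_mem_block _ (fun k => A i j * (enum_val j \in D k)%:R) _ ik0) !mxE.
case: existsP => [[k /andP[ik jk]]|nex].
  have -> : k0 = k; last by rewrite jk mulr1.
  apply/eqP; apply: contraT => /D_disj dk.
  by rewrite (disjointFr dk ik0) in ik.
case: (boolP (_ \in _)) => [jk0|_]; last by rewrite mulr0.
by case: nex; exists k0; rewrite ik0 jk0.
Qed.

(** Cross terms contain [E k *m Et l] = 0 by disjointness; the diagonal ones reduce to
    [Et k *m E k], which sum to the identity. *)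
Lemma mul_blockdiag_inv (A : forall k, 'M[F]_#|D k|) :
    (forall k, A k \in unitmx) ->
  (\sum_k Et k *m A k *m E k) *m (\sum_k Et k *m invmx (A k) *m E k) = 1%:M.
Proof.
move=> unitA; rewrite -sum_selmx_proj mulmx_suml; apply: eq_bigr => k _.
rewrite mulmx_sumr (bigD1 k) //= big1 => [|l nl]; rewrite -!mulmxA.
  rewrite (mulmxA (E k)) selmx_comp ?sub_observed // selmx_id mul1mx.
  by rewrite (mulKVmx (unitA k)) addr0.
rewrite (mulmxA (E k)) selmx_comp ?sub_observed // selmx_disjoint.
  by rewrite mul0mx !mulmx0.
by apply: D_disj; rewrite eq_sym.
Qed.

End BlockDiagonal.

(** * Covariance and posterior covariance matrices *)

Section Covariance.
Context {R : realType} {V : finType} {sigma : V -> V -> R}.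
Implicit Types A B C : {set V}.

Lemma sel_covmx A B C : A \subset B ->
  selmx A B *m covmx sigma B C = covmx sigma A C.
Proof. exact: (selmx_mul A B _ (fun s j => sigma s (enum_val j))). Qed.

Lemma sel_subvec (f : V -> R) A B : A \subset B ->
  selmx A B *m subvec f B = subvec f A.
Proof. exact: (selmx_mul A B _ (fun s _ => f s)). Qed.

Hypothesis sigma_sym : cov_symmetric sigma.

Lemma tr_covmx A B : (covmx sigma A B)^T = covmx sigma B A.
Proof. by apply/matrixP => i j; rewrite !mxE sigma_sym. Qed.

Lemma covmx_sel A B C : A \subset B ->
  covmx sigma C B *m selmx B A = covmx sigma C A.
Proof.
move=> sAB; apply: trmx_inj.
by rewrite trmx_mul tr_selmx !tr_covmx sel_covmx.
Qed.

(** Conditioning on the same U commutes with restriction, so the diagonal blocks of the posterior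
    covariance of [observed D] are those of the single sensors. *)
Lemma sel_postcov (U : {set V}) A B : A \subset B ->
  selmx A B *m postcov sigma U B *m selmx B A = postcov sigma U A.
Proof.
move=> sAB; rewrite /postcov mulmxBr mulmxBl !mulmxA !sel_covmx //.
by rewrite -[in LHS]mulmxA -!mulmxA !covmx_sel // !mulmxA.
Qed.

Lemma tr_invcov (U : {set V}) :
  (invmx (covmx sigma U U))^T = invmx (covmx sigma U U).
Proof. by rewrite trmx_inv tr_covmx. Qed.

Lemma tr_postcov (U : {set V}) B : (postcov sigma U B)^T = postcov sigma U B.
Proof.
by rewrite /postcov linearB /= !trmx_mul tr_invcov !tr_covmx !mulmxA.
Qed.

Hypothesis sigma_psd : cov_psd sigma.

Lemma psdmx_covT : psdmx (covmx sigma [set: V] [set: V]).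
Proof.
move=> x.
(* This is x read as a function on V; the sum stands in for an inverse of [enum_val]. *)
pose y s := \sum_(i < #|[set: V]|) x 0 i * (enum_val i == s)%:R.
have yE i : y (enum_val i) = x 0 i.
  rewrite /y (bigD1 i) //= eqxx mulr1 big1 ?addr0 // => j nj.
  by rewrite (inj_eq enum_val_inj) (negPf nj) mulr0.
suff -> : (x *m covmx sigma [set: V] [set: V] *m x^T) 0 0
    = \sum_s \sum_s' y s * sigma s s' * y s' by apply: sigma_psd.
have sumT (g : V -> R) : \sum_s g s = \sum_(i < #|[set: V]|) g (enum_val i).
  by rewrite -big_enum_val /=; apply: eq_bigl => s; rewrite finset.inE.
rewrite mxE (exchange_big _ _ _ _ _ _) /= sumT; apply: eq_bigr => j _.
rewrite !mxE sumT mulr_suml; apply: eq_bigr => i _.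
by rewrite !mxE !yE.
Qed.

(** Brings every block back to the covariance matrix on all of V, the one that [cov_psd] speaks
    of. *)
Lemma covmx_congr A B :
  covmx sigma A B =
  selmx A [set: V] *m covmx sigma [set: V] [set: V] *m (selmx B [set: V])^T.
Proof.
by rewrite tr_selmx sel_covmx ?finset.subsetT // covmx_sel ?finset.subsetT.
Qed.

Lemma psdmx_cov B : psdmx (covmx sigma B B).
Proof. by rewrite covmx_congr; apply/psdmx_congr/psdmx_covT. Qed.

(** The posterior covariance is the covariance of the residual of regressing B on U; W is the matrix
    that maps the whole process to this residual. *)
Lemma psdmx_postcov (U : {set V}) B :
  covmx sigma U U \in unitmx -> psdmx (postcov sigma U B).
Proof.
move=> unitU.
pose X := covmx sigma B U *m invmx (covmx sigma U U).
pose W := selmx B [set: V] - X *m selmx U [set: V].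
suff -> : postcov sigma U B = W *m covmx sigma [set: V] [set: V] *m W^T.
  exact/psdmx_congr/psdmx_covT.
rewrite /W linearB /= trmx_mul !mulmxBl !mulmxBr -!mulmxA.
rewrite !(mulmxA (selmx _ _)) !(mulmxA _ (selmx _ _)^T) -!covmx_congr.
(* The terms with X on the left cancel: the residual is uncorrelated with the variables of U. *)
rewrite (mulKmx unitU) trmx_mul tr_invcov tr_covmx subrr subr0.
by rewrite mulmxA.
Qed.

End Covariance.

(** * The global summary expressed through [Lambda] *)

Section Summaries.
Context {R : realType} {V : finType} {mu : V -> R} {sigma : V -> V -> R}.
Context {U : {set V}} {K : nat} {D : 'I_K -> {set V}}.
Hypothesis sigma_sym : cov_symmetric sigma.
Hypothesis D_disj : forall k l : 'I_K, k != l -> [disjoint D k & D l].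
Hypothesis invD : forall k : 'I_K, postcov sigma U (D k) \in unitmx.

Lemma Lambda_blocks :
  Lambda sigma U D = \sum_k selmx (observed D) (D k) *m postcov sigma U (D k)
                           *m selmx (D k) (observed D).
Proof.
rewrite /Lambda -blockdiag_mask //; apply: eq_bigr => k _.
by rewrite sel_postcov // sub_observed.
Qed.

Lemma Lambda_inv :
  Lambda sigma U D \in unitmx /\
  invmx (Lambda sigma U D) =
    \sum_k selmx (observed D) (D k) *m invmx (postcov sigma U (D k))
           *m selmx (D k) (observed D).
Proof.
have LN := mul_blockdiag_inv D_disj _ invD.
rewrite -Lambda_blocks in LN; have [unitL _] := mulmx1_unit LN.
by split=> //; rewrite -[RHS](mulKmx unitL) LN mulmx1.
Qed.

(** The right factor X is arbitrary so that both halves of the global summary follow: X is the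
    centred data for [global_z], the covariance with U for [global_cov]. *)
Lemma mul_invLambda n (X : 'M[R]_(#|observed D|, n)) :
  covmx sigma U (observed D) *m invmx (Lambda sigma U D) *m X =
  \sum_k covmx sigma U (D k) *m invmx (postcov sigma U (D k))
         *m (selmx (D k) (observed D) *m X).
Proof.
rewrite Lambda_inv.2 mulmx_sumr mulmx_suml; apply: eq_bigr => k _.
by rewrite !mulmxA covmx_sel // sub_observed.
Qed.

Lemma global_zE (z : V -> R) :
  global_z mu sigma U z D = covmx sigma U (observed D) *m
    invmx (Lambda sigma U D) *m (subvec z (observed D) - subvec mu (observed D)).
Proof.
rewrite mul_invLambda; apply: eq_bigr => k _.
by rewrite mulmxBr !sel_subvec // sub_observed.
Qed.

Lemma global_covE :
  global_cov sigma U D = covmx sigma U U + covmx sigma U (observed D) *m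
    invmx (Lambda sigma U D) *m covmx sigma (observed D) U.
Proof.
rewrite mul_invLambda; congr (_ + _); apply: eq_bigr => k _.
by rewrite sel_covmx // sub_observed.
Qed.

Lemma global_cov_unitmx : cov_psd sigma -> covmx sigma U U \in unitmx ->
  global_cov sigma U D \in unitmx.
Proof.
move=> sigma_psd invU; apply: unitmx_psdD => //.
- exact: tr_covmx.
- exact: psdmx_cov.
apply: psdmx_sum => k; rewrite /local_cov -[covmx sigma (D k) U]tr_covmx //.
apply/psdmx_congr/psdmx_inv => //; first exact: tr_postcov.
exact: psdmx_postcov.
Qed.

End Summaries.

Theorem theorem1 (R : realType) (d : measure_display) (T : measurableType d)
    (P : probability T R) (V : finType) (Z : V -> {RV P >-> R})
    (mu : V -> R) (sigma : V -> V -> R)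
    (hZ : gaussian_process Z)
    (hmu : has_prior_mean Z mu)
    (hsigma : has_prior_covariance Z sigma)
    (sigma_sym : cov_symmetric sigma)
    (sigma_psd : cov_psd sigma)
    (U : {set V}) (K : nat) (D : 'I_K -> {set V}) (z : V -> R) (Y : {set V})
    (D_disj : forall k l : 'I_K, k != l -> [disjoint D k & D l])
    (Y_unobs : Y \subset (~: observed D)%SET)
    (invU : covmx sigma U U \in unitmx)
    (invD : forall k : 'I_K, postcov sigma U (D k) \in unitmx) :
  pred_mean mu sigma (global_z mu sigma U z D) (global_cov sigma U D) Y
    = pitc_mean mu sigma U z D Y
  /\
  pred_cov sigma (global_cov sigma U D) Y = pitc_cov sigma U D Y.
Proof.
have [unitL _] := Lambda_inv sigma_sym D_disj invD.
have GE := global_covE sigma_sym D_disj invD.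
have unitG := global_cov_unitmx sigma_sym invD sigma_psd invU.
rewrite GE in unitG.
have push := woodbury_push_through invU unitL unitG.
rewrite -GE in push unitG.
(* The PITC gain, rewritten with the inverse of the global covariance; the means then agree
   directly. *)
have gain : Gamma sigma U Y (observed D) *m
      invmx (Gamma sigma U (observed D) (observed D) + Lambda sigma U D)
    = covmx sigma Y U *m (invmx (global_cov sigma U D) *m
        covmx sigma U (observed D) *m invmx (Lambda sigma U D)).
  by rewrite -push !mulmxA.
split.
  by rewrite /pred_mean /pitc_mean gain global_zE // !mulmxA.
rewrite /pred_cov /pitc_cov gain /Gamma; congr (_ - _).
rewrite -!mulmxA; congr (_ *m _); rewrite !mulmxA; congr (_ *m _).
rewrite -2!(mulmxA (invmx (global_cov sigma U D))).
(* Since B L^-1 C = G - S, the middle factor is G^-1 (G - S) S^-1 = S^-1 - G^-1. *)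
have -> : covmx sigma U (observed D) *m invmx (Lambda sigma U D) *m
    covmx sigma (observed D) U = global_cov sigma U D - covmx sigma U U.
  by rewrite GE addrC addKr.
by rewrite mulmxBr (mulVmx unitG) mulmxBl mul1mx (mulmxK invU).
Qed.
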